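(* Let $\sigma=\sigma_{l,r}=\sigma_1\cdots\sigma_n$ be any turn sequence with $l$ left turns and $r$ right turns, $l-r\ge 0$, such that some point of the $+x$-axis is reachable by $\sigma$. Then $x^+_{l,r}$ satisfies the following lower bounds, where the numbers ${}_{+x}m^o_{\pm y}$, ${}_{+x}m^p_{\pm y}$ are those of $\sigma$: (1) $l-r\equiv 1\pmod 4$: if $\sigma_1=\texttt{R}$, then $x^+_{l,r}\ge\min\{{}_{+x}m^o_{-y},\,{}_{+x}m^p_{+y}\}+\left\lfloor\frac{l-r+2}{4}\right\rfloor+1$; if $\sigma_1=\texttt{L}$, then $x^+_{l,r}\ge\left|\left\lfloor\frac{l-r+2}{4}\right\rfloor-1\right|+2$. (2) $l-r\equiv 3\pmod 4$: if $\sigma_1=\texttt{L}$, then $x^+_{l,r}\ge\min\{{}_{+x}m^o_{+y},\,{}_{+x}m^p_{-y}\}+\left|\left\lfloor\frac{l-r}{4}\right\rfloor-1\right|+1=\min\{{}_{+x}m^o_{+y},\,{}_{+x}m^p_{-y}\}+\left|\left\lfloor\frac{l-r+2}{4}\right\rfloor-2\right|+1$; if $\sigma_1=\texttt{R}$, then $x^+_{l,r}\ge\left\lfloor\frac{l-r}{4}\right\rfloor+2=\left\lfloor\frac{l-r+2}{4}\right\rfloor+1$. (3) $l-r\equiv 2\pmod 4$: if $\sigma_1=\texttt{L}$, then $x^+_{l,r}\ge\left|\left\lfloor\frac{l-r}{4}\right\rfloor-1\right|+2=\left|\left\lfloor\frac{l-r+2}{4}\right\rfloor-2\right|+2$; if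 $\sigma_1=\texttt{R}$, then $x^+_{l,r}\ge\left\lfloor\frac{l-r}{4}\right\rfloor+2=\left\lfloor\frac{l-r+2}{4}\right\rfloor+1$. (4) $l-r\equiv 0\pmod 4$ and $l-r\ge 8$: if $\sigma_1=\texttt{L}$, then $x^+_{l,r}\ge\min\{{}_{+x}m^o_{+y},\,{}_{+x}m^p_{-y},\,2\}+\left\lfloor\frac{l-r+2}{4}\right\rfloor$; if $\sigma_1=\texttt{R}$, then $x^+_{l,r}\ge\left\lfloor\frac{l-r+2}{4}\right\rfloor+2$. (5) $l-r=0$: if $\sigma_1=\texttt{L}$, then $x^+_{l,r}\ge\min\{{}_{+x}m^o_{+y},\,{}_{+x}m^p_{-y},\,2\}+2$; otherwise, $x^+_{l,r}\ge\min\{{}_{+x}m^o_{-y},\,{}_{+x}m^p_{+y},\,2\}+2$. (6) $l-r=4$: $x^+_{l,r}\ge 3$.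
   Context: A turn sequence is a finite word $\sigma=\sigma_1\cdots\sigma_n$ with $\sigma_i\in\{\texttt{L},\texttt{R}\}$ (left turn, right turn); $\sigma_{l,r}$ denotes a turn sequence with $l$ left turns and $r$ right turns, $n=l+r$. A rectilinear chain realizes $\sigma$ if it is simple (no self-intersection), consists of $n+1$ axis-parallel segments of positive integer length, starts at the origin $o=(0,0)$ with its first segment heading east (direction $+x$), and at its $n$ successive bends makes the $90^\circ$ turns $\sigma_1,\dots,\sigma_n$ in order. Its endpoint $p\in\mathbb{Z}^2$ is said to be reachable by $\sigma$. The $+x$-axis is $\{(a,0):a>0\}$. If $\sigma$ reaches the $+x$-axis, $(x^+_\sigma,0)$ denotes the point of the $+x$-axis reachable by $\sigma$ that is closest to $o$. The quantity $x^+_{l,r}$ is the maximum $x^+_{l,r}=\max_{\sigma_{l,r}}|x^+_{\sigma_{l,r}}|$ over all turn sequences $\sigma_{l,r}$ with $l$ left turns and $r$ right turns (for which $x^+_{\sigma_{l,r}}$ exists). Directions: with $\delta_i$ the number of $\texttt{L}$ minus the number of $\texttt{R}$ among $\sigma_1,\dots,\sigma_i$ ($\delta_0=0$), the $(i+1)$st segment of any chain realizing $\sigma$, directed from $o$ towards the endpoint $p$, is a $+x$-, $+y$-, $-x$-, $-y$-segment (has that direction) according to $\delta_i\equiv 0,1,2,3\pmod 4$. For $z\in\{+y,-y\}$, ${}_{+x}m^o_{z}$ (resp. ${}_{+x}m^p_{z}$) is the number of $z$-segments in the maximal $(+x,z)$-staircase of the chain containing $o$ (resp. $p$), i.e. in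 the longest initial (resp. terminal) run of consecutive segments of the chain all of which are $+x$-segments or $z$-segments. These numbers depend only on $\sigma$. *)

(* Defs.v *)
From HB Require Import structures.
From mathcomp Require Import all_boot all_order all_algebra.
From mathcomp Require Import boolp classical_sets reals.

Set Implicit Arguments.
Unset Strict Implicit.
Unset Printing Implicit Defensive.

Import Order.TTheory GRing.Theory Num.Theory.
Local Open Scope classical_set_scope.
Local Open Scope ring_scope.

Inductive turn := LT | RT.

Definition bool_of_turn (t : turn) : bool := if t is LT then true else false.
Definition turn_of_bool (b : bool) : turn := if b then LT else RT.

Lemma bool_of_turnK : cancel bool_of_turn turn_of_bool.
Proof. by case. Qed.

HB.instance Definition _ := Finite.copy turn (can_type bool_of_turnK).

Inductive dir := PX | PY | NX | NY.

Definition nat_of_dir (d : dir) : nat :=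
  match d with PX => 0 | PY => 1 | NX => 2 | NY => 3 end.
Definition dir_of_nat (k : nat) : dir :=
  match k with 0 => PX | 1 => PY | 2 => NX | _ => NY end.

Lemma nat_of_dirK : cancel nat_of_dir dir_of_nat.
Proof. by case. Qed.

HB.instance Definition _ := Equality.copy dir (can_type nat_of_dirK).

Definition has_turns (l r : nat) (s : seq turn) : bool :=
  (count_mem LT s == l) && (count_mem RT s == r).

Definition delta (s : seq turn) (i : nat) : int :=
  (count_mem LT (take i s))%:Z - (count_mem RT (take i s))%:Z.

(* Segments are numbered from 0, so segment i follows the first i turns. *)
Definition seg_dir (s : seq turn) (i : nat) : dir :=
  dir_of_nat `|(delta s i %% 4)%Z|%N.

Definition dirs (s : seq turn) : seq dir :=
  [seq seg_dir s i | i <- iota 0 (size s).+1].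

Definition unit_vec (d : dir) : int * int :=
  match d with
  | PX => (1, 0) | PY => (0, 1) | NX => (-1, 0) | NY => (0, -1)
  end.

(* A chain with turn sequence s is determined by the list w of its segment
   lengths; vertex s w 0 is the origin, and segment i joins vertices i and
   i.+1. *)
Definition vertex (s : seq turn) (w : seq nat) (i : nat) : int * int :=
  \sum_(k < i) unit_vec (seg_dir s k) *+ nth 0%N w k.

Section Plane.
Variable R : realType.

Definition embed (p : int * int) : R * R := (p.1%:~R, p.2%:~R).

Definition segment (a b : R * R) : set (R * R) :=
  [set z | exists t : R, 0 <= t <= 1 /\
    z = ((1 - t) * a.1 + t * b.1, (1 - t) * a.2 + t * b.2)].

Definition chain_segment (s : seq turn) (w : seq nat) (i : nat) : set (R * R) :=
  segment (embed (vertex s w i)) (embed (vertex s w i.+1)).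

(* Two distinct segments may meet only if they are consecutive, and then only
   in their common bend. *)
Definition simple_chain (s : seq turn) (w : seq nat) : Prop :=
  forall (i j : nat) (z : R * R), (i < j <= size s)%N ->
    chain_segment s w i z -> chain_segment s w j z ->
    j = i.+1 /\ z = embed (vertex s w j).

Definition realizes (s : seq turn) (w : seq nat) : Prop :=
  [/\ size w = (size s).+1, all (fun k => 0 < k)%N w & simple_chain s w].

Definition reachable (s : seq turn) (p : int * int) : Prop :=
  exists2 w : seq nat, realizes s w & vertex s w (size s).+1 = p.

Definition xaxis_dists (s : seq turn) : set nat :=
  [set a | (0 < a)%N /\ reachable s (a%:Z, 0)].

Definition reaches_pos_xaxis (s : seq turn) : Prop :=
  exists a, xaxis_dists s a.

(* Default value 0 if s does not reach the +x-axis. *)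
Definition xplus (s : seq turn) : nat :=
  xget 0%N [set a | xaxis_dists s a /\
                    forall b, xaxis_dists s b -> (a <= b)%N].

Definition xplus_max (l r : nat) : nat :=
  (\max_(s : (l + r).-tuple turn | has_turns l r s && `[< reaches_pos_xaxis s >])
     xplus s)%N.

End Plane.

Definition initial_run (P : pred dir) (ds : seq dir) : seq dir :=
  take (find (predC P) ds) ds.

Definition staircase_count (z : dir) (ds : seq dir) : nat :=
  count_mem z (initial_run (mem [:: PX; z]) ds).

Definition m_o (z : dir) (s : seq turn) : nat := staircase_count z (dirs s).
Definition m_p (z : dir) (s : seq turn) : nat :=
  staircase_count z (rev (dirs s)).

(* Main.v *)
(* Expand a chain into unit steps and count its turning in quarter turns.  For a
   closed simple lattice walk the turning is 4 or -4; Hopf's homotopy argument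
   proves this on the grid of secants v_j - v_i, where "crossings of a half-line"
   form a cocycle that sums to zero around every unit square of indices, and the
   base vertex is the lowest, leftmost one.

   Now let an open simple walk go from a point to another one at distance x > 0
   to its right.  If it avoids the open segment between its endpoints, closing it
   up shows that its turning is 4 or -4 up to a correction depending only on the
   end directions.  Otherwise cut it at a lattice point of that segment: both
   pieces again run from left to right, so the corrections telescope, and by
   induction the turning is 4 j plus the correction with |j| <= x.

   This bounds x below once the initial and final +x-steps have been removed.
   When the two extremal staircases leave the axis on the same side, removing
   their steps from both ends simultaneously, always keeping the two endpoints on
   a common horizontal line, gains one unit of x per stair.  The estimate holds
   for every point of the +x-axis reached by the given turn sequence, hence for
   its x^+ and for the maximum. *)
Require Import Defs.
From HB Require Import structures.
From mathcomp Require Import all_boot all_order all_algebra.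
From mathcomp Require Import boolp classical_sets reals.
From mathcomp Require Import zify ring.

Set Implicit Arguments.
Unset Strict Implicit.
Unset Printing Implicit Defensive.

Import Order.TTheory GRing.Theory Num.Theory.
Local Open Scope ring_scope.

(** * Turning of closed lattice walks *)

Definition ux (d : dir) : int := (unit_vec d).1.
Definition uy (d : dir) : int := (unit_vec d).2.

(** A U-turn gets the default value 0, like going straight on; simple walks make none. *)
Definition quarter_turn (a b : dir) : int :=
  match a, b with
  | PX, PY | PY, NX | NX, NY | NY, PX => 1
  | PY, PX | NX, PY | NY, NX | PX, NY => -1
  | _, _ => 0
  end.

Definition walk (X Y : nat -> int) (s : nat -> dir) : Prop :=
  forall i, X i.+1 = X i + ux (s i) /\ Y i.+1 = Y i + uy (s i).

Definition gt0 (z : int) : int := if 0 < z then 1 else 0.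

(* For a unit step from height [y] to height [y'] starting at abscissa [x]: the
   signed number of crossings of the half-line at height 1/2 with positive
   abscissa.  Horizontal steps count 0, and vertical ones keep [x]. *)
Definition cross (x y y' : int) : int := gt0 x * (gt0 y' - gt0 y).

Lemma gt0P (z : int) : gt0 z = 1 /\ 0 < z \/ gt0 z = 0 /\ z <= 0.
Proof. by rewrite /gt0; case: ltP; [left | right]. Qed.

(** The half-line may be taken to end at [(1/2, 1/2)], and the only unit square around that end has
    the origin as a corner. On every other square, also on a degenerate one, the crossings
    cancel. *)
Lemma cross_square (x y : int) (d e : dir) :
  x <> 0 \/ y <> 0 -> x - ux d <> 0 \/ y - uy d <> 0 ->
  x + ux e <> 0 \/ y + uy e <> 0 ->
  x + ux e - ux d <> 0 \/ y + uy e - uy d <> 0 ->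
  cross x y (y + uy e) + cross (x + ux e) (y + uy e) (y + uy e - uy d) =
  cross x y (y - uy d) + cross (x - ux d) (y - uy d) (y + uy e - uy d).
Proof.
rewrite /cross /ux /uy.
case: d; case: e => /=; rewrite ?(addr0, subr0, addrK, subrK, opprK, subrr, mulr0) //.
all: repeat match goal with |- context [gt0 ?z] =>
  case: (gt0P z) => [[-> ?]|[-> ?]]; try lia end.
Qed.

(* Crossings when the end, resp. the start, of the secant from vertex [i] to
   vertex [j] moves one step. *)
Definition crossR (X Y : nat -> int) (i j : nat) : int :=
  cross (X j - X i) (Y j - Y i) (Y j.+1 - Y i).
Definition crossL (X Y : nat -> int) (i j : nat) : int :=
  cross (X j - X i) (Y j - Y i) (Y j - Y i.+1).

Definition meet (X Y : nat -> int) (i j : nat) : Prop := X i = X j /\ Y i = Y j.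

Lemma cross_cell X Y s i j : walk X Y s ->
  ~ meet X Y i j -> ~ meet X Y i.+1 j ->
  ~ meet X Y i j.+1 -> ~ meet X Y i.+1 j.+1 ->
  crossR X Y i j + crossL X Y i j.+1 = crossL X Y i j + crossR X Y i.+1 j.
Proof.
move=> hw; rewrite /meet => h1 h2 h3 h4.
have := @cross_square (X j - X i) (Y j - Y i) (s i) (s j).
have [hX hY] := hw i; have [hX' hY'] := hw j.
rewrite /crossR /crossL !(hX, hY, hX', hY') in h1 h2 h3 h4 *.
rewrite !(addrAC _ (ux _)) !(addrAC _ (uy _)) !opprD !addrA => -> //; lia.
Qed.

Lemma cross_column X Y s c m : walk X Y s -> (c <= m)%N ->
  (forall i j, (c <= i < j)%N -> (j <= m.+2)%N -> ~ meet X Y i j) ->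
  \sum_(c <= i < m) crossL X Y i m.+2 =
  \sum_(c <= i < m) crossL X Y i m.+1 + crossR X Y m m.+1 - crossR X Y c m.+1.
Proof.
move=> hw cm hm; rewrite -addrA.
rewrite -(telescope_sumr (fun i => crossR X Y i m.+1) cm) -big_split /=.
apply: eq_big_nat => i /andP[ci im].
have h : crossR X Y i m.+1 + crossL X Y i m.+2 =
    crossL X Y i m.+1 + crossR X Y i.+1 m.+1.
  by apply: (cross_cell hw); apply: hm; lia.
lia.
Qed.

(** Discrete Stokes formula: the staircase path along the diagonal is pushed, column by column, onto
    the two legs of the triangle of index pairs. *)
Lemma cross_triangle X Y s m : walk X Y s ->
  (forall i j, (i < j <= m.+1)%N -> ~ meet X Y i j) ->
  \sum_(0 <= i < m) (crossR X Y i i.+1 + crossL X Y i i.+2) =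
  \sum_(1 <= j < m.+1) crossR X Y 0 j + \sum_(0 <= i < m) crossL X Y i m.+1.
Proof.
move=> hw; elim: m => [|m IH] hm; first by rewrite !big_geq.
rewrite big_nat_recr //= IH; last by move=> i j h; apply: hm; lia.
rewrite [in RHS]big_nat_recr //= [in X in _ = _ + X]big_nat_recr //=.
rewrite (cross_column (s := s)) //; last by move=> i j h1 h2; apply: hm; lia.
ring.
Qed.

(* The direction as a number of quarter turns, cut between [PX] and [PY]. *)
Definition angle (d : dir) : int :=
  match d with PX => 0 | PY => -3 | NX => -2 | NY => -1 end.

(** The secant swings from step [s i] to step [s i.+1] through the secant from [i] to [i.+2]; the
    change of [angle] misses the turn by 4 for each signed crossing. *)
Lemma quarter_turnE X Y s i : walk X Y s -> ~ meet X Y i i.+2 ->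
  quarter_turn (s i) (s i.+1) =
  4 * (crossR X Y i i.+1 + crossL X Y i i.+2) + (angle (s i.+1) - angle (s i)).
Proof.
move=> hw; rewrite /meet /crossR /crossL.
have [-> ->] := hw i.+1; have [-> ->] := hw i.
have e1 (a b : int) : a + b - a = b by lia.
have e2 (a b c : int) : a + b + c - a = b + c by lia.
have e3 (a b c : int) : a + b + c - (a + b) = c by lia.
rewrite !(e1, e2, e3).
rewrite /ux /uy /cross.
by case: (s i); case: (s i.+1) => //= h; exfalso; apply: h; split; lia.
Qed.

(** Secants out of the base never point down and secants into it never point up, so the crossings on
    both legs depend on the first and last steps only. *)
Lemma turning_lowest_base X Y s N : walk X Y s -> (2 < N)%N ->
  X N = X 0 -> Y N = Y 0 -> s N = s 0 ->
  (forall i j, (i < j < N)%N -> ~ meet X Y i j) ->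
  (forall j, (0 < j < N)%N -> Y 0 < Y j \/ Y 0 = Y j /\ X 0 < X j) ->
  let T := \sum_(0 <= i < N) quarter_turn (s i) (s i.+1) in T = 4 \/ T = -4.
Proof.
move=> hw; case: N => [|[|m]] // m1 hXN hYN hsN hm low T.
have hmN i : (0 < i < m.+2)%N -> ~ meet X Y i m.+2.
  by move=> h; rewrite /meet hXN hYN => -[e1 e2]; apply: (hm 0 i) => //; split.
have -> : T = 4 * (\sum_(0 <= i < m.+1) (crossR X Y i i.+1 + crossL X Y i i.+2))
    + (angle (s m.+1) - angle (s 0)) + quarter_turn (s m.+1) (s 0).
  rewrite /T big_nat_recr //= hsN; congr (_ + _).
  rewrite -(telescope_sumr (fun i => angle (s i)) (leq0n m.+1)) mulr_sumr -big_split /=.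
  apply: eq_big_nat => i /andP[_ im]; rewrite (quarter_turnE hw) //.
  case: (ltnP i m) => im'; first by apply: hm; lia.
  have -> : i = m by lia.
  by apply: hmN; lia.
rewrite big_nat_recr //= (cross_triangle hw); last by move=> i j h; apply: hm; lia.
have hm1 i j : (1 <= i < j)%N -> (j <= m.+2)%N -> ~ meet X Y i j.
  move=> h1 h2; case: (ltnP j m.+2) => h3; first by apply: hm; lia.
  have -> : j = m.+2 by lia.
  by apply: hmN; lia.
(* The secant from [0] to [m.+2] is zero, so the triangle stops at [m.+1]; the column from index 1
   on passes to secants into [m.+2], the base again. *)
have := cross_column hw (m1 : (1 <= m)%N) hm1.
rewrite (@big_ltn _ _ _ 0 m) //.
have far i : (0 < i < m.+1)%N -> crossL X Y i m.+2 = 0.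
  move=> h; rewrite /crossL /cross hXN hYN.
  have := low i; have := low i.+1.
  have := gt0P (Y 0 - Y i); have := gt0P (Y 0 - Y i.+1).
  by case=> [[_ ?]|[-> _]]; case=> [[_ ?]|[-> _]] h1 h2; rewrite ?subrr ?mulr0 //; lia.
rewrite [X in X = _ -> _]big1_seq; last first.
  by move=> i; rewrite mem_index_iota => h; apply: far; lia.
(* At height 0 a secant out of the base has positive abscissa, so every change of [gt0] of the
   height is a crossing. *)
have -> : \sum_(1 <= j < m.+1) crossR X Y 0 j = gt0 (Y m.+1 - Y 0) - gt0 (Y 1 - Y 0).
  rewrite -(telescope_sumr (fun i => gt0 (Y i - Y 0))) //.
  apply: eq_big_nat => j h; rewrite /crossR /cross.
  have [hX hY] := hw j.
  have := low j; have := low j.+1; have := gt0P (X j - X 0).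
  have := gt0P (Y j - Y 0); have := gt0P (Y j.+1 - Y 0).
  rewrite hX hY /ux /uy; case: (s j) => /=; rewrite ?addr0 ?subrr ?mulr0 //;
  case=> [[-> ?]|[-> ?]]; case=> [[-> ?]|[-> ?]]; case=> [[-> ?]|[-> ?]]; lia.
rewrite (far m) //; last by lia.
move=> col.
set S := \sum_(1 <= i < m) _ in col *.
have cancel (a l r1 rm : int) : S = r1 - rm -> a + (l + S) + (rm + 0) = a + l + r1.
  by move=> ->; ring.
rewrite (cancel _ _ (crossR X Y 1 m.+1)); last by lia.
clear S col cancel.
have := low 1 isT; have := low m.+1 (ltnSn _).
have := hm 1 m.+1; rewrite /meet /crossR /crossL /cross hYN.
have [-> ->] := hw 0%N; have [] := hw m.+1; rewrite hXN hYN.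
move=> /eqP; rewrite -subr_eq eq_sym => /eqP ->.
move=> /eqP; rewrite -subr_eq eq_sym => /eqP ->.
set x := X 0; set y := Y 0.
rewrite (_ : (1 < m.+1 < m.+2)%N = true); last by lia.
case: (s 0); case: (s m.+1); rewrite /ux /uy /=; move=> h1 h2 h3.
all: try by exfalso; lia.
all: rewrite !opprK ?subr0 ?addr0 ?opprD ?(addrAC _ 1) ?addrA ?subrr ?add0r ?subrr.
all: by rewrite ?mulr0 /gt0 /=; lia.
Qed.

Lemma sum_periodic (f : nat -> int) (N b : nat) : (forall i, f (i + N)%N = f i) ->
  \sum_(0 <= i < N) f (b + i)%N = \sum_(0 <= i < N) f i.
Proof.
move=> fN; elim: b => [|b <-]; first by apply: eq_bigr.
case: N fN => [|N] fN; first by rewrite !big_geq.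
rewrite [LHS]big_nat_recr //= [RHS]big_nat_recl //= addrC addSnnS fN addn0.
by congr (_ + _); apply: eq_bigr => i _; rewrite addSnnS.
Qed.

Lemma periodic_modn (T : Type) (f : nat -> T) N : (forall i, f (i + N)%N = f i) ->
  forall i, f (i %% N)%N = f i.
Proof.
move=> fN i; rewrite [in RHS](divn_eq i N) addnC.
by elim: (i %/ N)%N => [|k IH]; rewrite ?mul0n ?addn0 // mulSnr addnA fN.
Qed.

Lemma turning_closed_walk X Y s N : walk X Y s -> (2 < N)%N ->
  (forall i, X (i + N)%N = X i) -> (forall i, Y (i + N)%N = Y i) ->
  (forall i, s (i + N)%N = s i) ->
  (forall i j, (i < j < i + N)%N -> ~ meet X Y i j) ->
  let T := \sum_(0 <= i < N) quarter_turn (s i) (s i.+1) in T = 4 \/ T = -4.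
Proof.
move=> hw N2 hX hY hs hm T.
have N0 : (0 < N)%N by lia.
have [b hb] : exists b, forall j, (0 < j < N)%N ->
    Y b < Y (b + j)%N \/ Y b = Y (b + j)%N /\ X b < X (b + j)%N.
  pose i0 := Ordinal N0.
  case: (@arg_minP _ _ _ i0 xpredT (fun i : 'I_N => Y i) isT) => i1 _ min1.
  case: (@arg_minP _ _ _ i1 (fun i : 'I_N => Y i == Y i1) (fun i : 'I_N => X i) (eqxx _)).
  move=> b /eqP yb min2; exists b => j hj.
  have lt : ((b + j) %% N < N)%N by rewrite ltn_mod.
  rewrite -(periodic_modn hX (b + j)%N) -(periodic_modn hY (b + j)%N).
  have := hm b (b + j)%N; rewrite /meet.
  rewrite -(periodic_modn hX (b + j)%N) -(periodic_modn hY (b + j)%N).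
  have := min1 (Ordinal lt) isT; have := min2 (Ordinal lt).
  rewrite /= yb; move: (Y (_ %% _)%N) (X (_ %% _)%N) => y x h2 h1 h3.
  case: (y =P Y i1) => e; last by left; lia.
  by right; split=> //; have := h2 (introT eqP e); lia.
have -> : T = \sum_(0 <= i < N) quarter_turn (s (b + i)%N) (s (b + i).+1).
  rewrite (sum_periodic (f := fun i => quarter_turn (s i) (s i.+1)) b) // => i.
  by rewrite -addSn !hs.
have := @turning_lowest_base (fun i => X (b + i)%N) (fun i => Y (b + i)%N)
  (fun i => s (b + i)%N) N.
under eq_bigr do rewrite addnS.
apply; rewrite ?addn0 ?hX ?hY ?hs //.
- by move=> i; rewrite addnS; apply: hw.
- by move=> i j h; apply: hm; lia.
Qed.

(** * Turning of open walks between points of a horizontal line *)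

Definition turning (s : nat -> dir) (a b : nat) : int :=
  \sum_(a <= i < b.-1) quarter_turn (s i) (s i.+1).

Lemma modnS_cases i N : (0 < N)%N ->
  (i.+1 %% N = (i %% N).+1 /\ (i %% N).+1 < N)%N \/
  (i.+1 %% N = 0 /\ (i %% N).+1 = N)%N.
Proof.
move=> N0; have := ltn_pmod i N0; rewrite modnS; case: ifP => [dv|dv] lt.
  right; split=> //.
  move: dv; rewrite /dvdn -addn1 -modnDml addn1 => /eqP.
  move: (i %% N)%N lt => j; rewrite leq_eqVlt => /orP[/eqP //|lt].
  by rewrite modn_small.
left; split=> //; rewrite ltn_neqAle lt andbT; apply/eqP => e.
by move: dv; rewrite /dvdn -addn1 -modnDml addn1 e modnn.
Qed.

(** The walk is closed by [x] steps west. They meet no inner vertex of the walk by the last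
    hypothesis, and the two added terms are the turns at the new corners. *)
Lemma closed_turning X Y s a b x : walk X Y s -> (a.+1 < b)%N -> (0 < x)%N ->
  (forall i j, (a <= i < j)%N -> (j <= b)%N -> ~ meet X Y i j) ->
  X b = X a + x%:Z -> Y b = Y a ->
  (forall i, (a <= i <= b)%N -> Y i = Y a -> ~ (X a < X i < X b)) ->
  turning s a b + quarter_turn (s b.-1) NX + quarter_turn NX (s a) = 4 \/
  turning s a b + quarter_turn (s b.-1) NX + quarter_turn NX (s a) = -4.
Proof.
move=> hw ab x0 hm hX hY hopen; set T := _ + _ + _.
pose L := (b - a)%N; pose N := (L + x)%N.
have N0 : (0 < N)%N by lia.
pose S0 j := if (j < L)%N then s (a + j)%N else NX.
pose X0 j := if (j <= L)%N then X (a + j)%N else X b - (j - L)%N%:Z.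
pose Y0 j := if (j <= L)%N then Y (a + j)%N else Y a.
have abL : b = (a + L)%N by lia.
have w0 j : (j.+1 < N)%N -> X0 j.+1 = X0 j + ux (S0 j) /\ Y0 j.+1 = Y0 j + uy (S0 j).
  move=> jN; rewrite /X0 /Y0 /S0; case: (ltngtP j L) => jL.
  - by rewrite addnS; apply: hw.
  - by rewrite /ux /uy /=; lia.
  - by rewrite jL -abL /ux /uy /= hY; lia.
have wN : X0 0%N = X0 N.-1 + ux (S0 N.-1) /\ Y0 0%N = Y0 N.-1 + uy (S0 N.-1).
  rewrite /X0 /Y0 /S0 ltnNge (_ : (L <= N.-1)%N); last by lia.
  rewrite /= addn0 /ux /uy /=; case: ltngtP => h; try by lia.
  by rewrite h -abL hY; lia.
have inj p q : (p < q < N)%N -> ~ meet X0 Y0 p q.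
  move=> pq; rewrite /meet /X0 /Y0.
  case: (leqP q L) => qL; first by rewrite (_ : (p <= L)%N); [apply: hm|]; lia.
  case: (leqP p L) => pL; last by lia.
  by case=> e1 e2; apply: (hopen (a + p)%N) => //; lia.
have hT := @turning_closed_walk (fun i => X0 (i %% N)%N) (fun i => Y0 (i %% N)%N)
  (fun i => S0 (i %% N)%N) N.
suff -> : T = \sum_(0 <= i < N) quarter_turn (S0 (i %% N)%N) (S0 (i.+1 %% N)%N).
  apply: hT => [i||i|i|i|i j ij]; rewrite ?modnDr //; last 2 first.
  - by lia.
  - have ne : (i %% N != j %% N)%N.
      apply/eqP => /esym/eqP; rewrite eqn_mod_dvd; last by lia.
      by move=> /dvdn_leq; lia.
    move: ne (ltn_pmod i N0) (ltn_pmod j N0); rewrite /meet.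
    move: (i %% N)%N (j %% N)%N => p q ne hp hq [e1 e2].
    case: (ltngtP p q) ne => // pq _; first by apply: (inj p q); [lia|split].
    by apply: (inj q p); [lia|split].
  - case: (modnS_cases i N0) => [[-> h]|[-> h]]; first exact: w0.
    by rewrite (_ : i %% N = N.-1)%N //; lia.
(* One period splits into the turns of the walk, the corner at its end, zeros along the way west,
   and the corner at its start. *)
rewrite (big_cat_nat (n := L.-1)) //=; last by lia.
rewrite /T -addrA; congr (_ + _).
  rewrite /turning -{1}(add0n a) big_addn (_ : b.-1 - a = L.-1)%N; last by lia.
  apply: eq_big_nat => i iL; rewrite !modn_small; try lia.
  by rewrite /S0 !ifT ?addnS 1?addnC //; lia.
rewrite (@big_ltn _ _ _ L.-1 N); last by lia.
have -> : L.-1.+1 = L by lia.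
rewrite -(prednK N0) big_nat_recr /=; last by lia.
rewrite prednK // big1_seq => [|i]; last first.
  rewrite mem_index_iota => /andP[_ h]; rewrite /S0 !modn_small; try lia.
  by rewrite !ifF //; lia.
rewrite modnn add0r !modn_small; try lia.
rewrite /S0 ltnn addn0 (_ : (N.-1 < L)%N = false); last by lia.
by rewrite !ifT; [congr (quarter_turn (s _) _ + _)| |]; lia.
Qed.

(* Angle from west to [d], in quarter turns; the U-turn to east counts as
   either [2] or [-2]. *)
Definition west_angle (d : dir) (t : int) : Prop :=
  match d with PX => t = 2 \/ t = -2 | PY => t = -1 | NX => t = 0 | NY => t = 1 end.

Lemma turning_split s a t b : (a < t < b)%N ->
  turning s a b = turning s a t + quarter_turn (s t.-1) (s t) + turning s t b.
Proof.
move=> h; have et : t = t.-1.+1 by lia.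
rewrite /turning (big_cat_nat (n := t.-1)) /=; [|lia|lia].
by rewrite (@big_ltn _ _ _ t.-1 b.-1) -?et ?addrA //; lia.
Qed.

(** The double value at [PX] is chosen to fit the neighbour: 2 next to [NY], -2 next to [PY]. Hence
    corrections telescope at a cut. *)
Lemma west_angle_turn X Y s i : walk X Y s -> ~ meet X Y i i.+2 ->
  exists t t', [/\ west_angle (s i) t, west_angle (s i.+1) t' &
                   quarter_turn (s i) (s i.+1) = t' - t].
Proof.
move=> hw hm; have {hm} : ux (s i) + ux (s i.+1) <> 0 \/ uy (s i) + uy (s i.+1) <> 0.
  apply: contrapT => /not_orP[/contrapT e1 /contrapT e2]; apply: hm; rewrite /meet.
  by have [-> ->] := hw i.+1; have [-> ->] := hw i; lia.
rewrite /ux /uy; case: (s i); case: (s i.+1) => //= h; try by exfalso; lia.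
- by exists 2, 2; split=> //; left.
- by exists (-2), (-1); split=> //; right.
- by exists 2, 1; split=> //; left.
- by exists (-1), (-2); split=> //; right.
- by exists (-1), (-1).
- by exists (-1), 0.
- by exists 0, (-1).
- by exists 0, 0.
- by exists 0, 1.
- by exists 1, 2; split=> //; left.
- by exists 1, 0.
- by exists 1, 1.
Qed.

(** For ends that do not point east the west angle is single-valued, and the corners of the closed
    walk turn by [ta] and [- tb]. *)
Lemma turning_tight X Y s a b x : walk X Y s -> (a < b)%N -> (0 < x)%N ->
  (forall i j, (a <= i < j)%N -> (j <= b)%N -> ~ meet X Y i j) ->
  X b = X a + x%:Z -> Y b = Y a -> s a <> PX -> s b.-1 <> PX ->
  (forall i, (a < i < b)%N -> Y i = Y a -> ~ (X a < X i < X b)) ->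
  forall ta tb, west_angle (s a) ta -> west_angle (s b.-1) tb ->
  turning s a b = 4 + tb - ta \/ turning s a b = -4 + tb - ta.
Proof.
move=> hw ab x0 hm hX hY ha hb hopen ta tb wa wb.
have ab' : (a.+1 < b)%N.
  rewrite ltn_neqAle ab andbT; apply/eqP => e; move: hX; rewrite -e.
  by have [-> _] := hw a; move: ha; rewrite /ux; case: (s a) => //= _; lia.
have := closed_turning hw ab' x0 hm hX hY.
have -> : quarter_turn (s b.-1) NX = - tb.
  by move: hb wb; case: (s b.-1) => //= _ ->.
have -> : quarter_turn NX (s a) = ta.
  by move: ha wa; case: (s a) => //= _ ->.
case=> [i ib ey|e|e]; [|left; lia|right; lia].
have [ei|ei] := eqVneq i a; first by rewrite ei; lia.
have [ej|ej] := eqVneq i b; first by rewrite ej; lia.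
by apply: hopen => //; lia.
Qed.

Lemma turning_bound X Y s x a b : walk X Y s -> (a < b)%N -> (0 < x)%N ->
  (forall i j, (a <= i < j)%N -> (j <= b)%N -> ~ meet X Y i j) ->
  X b = X a + x%:Z -> Y b = Y a ->
  forall ta tb, west_angle (s a) ta -> west_angle (s b.-1) tb ->
  exists j : int, turning s a b = 4 * j + tb - ta /\ `|j| <= x%:Z.
Proof.
move=> hw; elim/ltn_ind: x a b => x IH a b ab x0 hm hX hY ta tb wa wb.
have [[t [tab eY /andP[t1 t2]]]|hopen] := pselect (exists t,
    [/\ (a < t < b)%N, Y t = Y a & X a < X t < X b]).
  have [|ta' [tb' [wa' wb' et]]] := @west_angle_turn X Y s t.-1 hw _.
    by apply: hm; lia.
  have et1 : t.-1.+1 = t by lia.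
  rewrite et1 in wb' et.
  have [j [ej hj]] : exists j,
      turning s a t = 4 * j + ta' - ta /\ `|j| <= `|X t - X a|%N%:Z.
    by apply: IH => //; try lia; move=> i j h1 h2; apply: hm; lia.
  have [j' [ej' hj']] : exists j,
      turning s t b = 4 * j + tb - tb' /\ `|j| <= `|X b - X t|%N%:Z.
    by apply: IH => //; try lia; move=> i j' h1 h2; apply: hm; lia.
  by exists (j + j'); rewrite (turning_split s tab) ej ej' et; lia.
have [ha|ha] := pselect (s a = PX); last first.
  (* A last step east would come from the open segment or from the starting point. *)
  have [hb|hb] := pselect (s b.-1 = PX).
    have [hXb hYb] := hw b.-1; move: hXb hYb; rewrite hb prednK ?/ux ?/uy /=; last by lia.
    move=> hXb hYb; have [e|ne] := eqVneq b a.+1; first by move: ha; rewrite -hb e.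
    have [e1|ne1] := eqVneq (X b.-1) (X a).
      by case: (hm a b.-1); try lia; split; lia.
    by case: hopen; exists b.-1; split; lia.
  have [|e|e] := turning_tight hw ab x0 hm hX hY ha hb _ wa wb.
  - by move=> i ib ey xi; apply: hopen; exists i.
  - by exists 1; rewrite e; lia.
  - by exists (-1); rewrite e; lia.
(* A first step east not ending in the open segment reaches the endpoint at once. The signs of [ta]
   and [tb] are then independent, whence [j] is 0, 1 or -1. *)
have e : b = a.+1.
  have := hw a; rewrite ha /ux /uy /= => -[hXa hYa].
  apply: contrapT => ne; have [e1|ne1] := eqVneq (X a.+1) (X b).
    by case: (hm a.+1 b); try lia; split; lia.
  by case: hopen; exists a.+1; split; lia.
move: wb; rewrite /turning e /= big_geq // => wb.
move: wa wb; rewrite ha /= => -[->|->] [->|->].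
- by exists 0; lia.
- by exists 1; lia.
- by exists (-1); lia.
- by exists 0; lia.
Qed.

(** * Removing staircases *)

Lemma turning_recl s a b : (a.+1 < b)%N ->
  turning s a b = quarter_turn (s a) (s a.+1) + turning s a.+1 b.
Proof. by move=> h; rewrite /turning big_ltn //; lia. Qed.

Lemma turning_recr s a b : (a < b.-1)%N ->
  turning s a b = turning s a b.-1 + quarter_turn (s b.-2) (s b.-1).
Proof.
move=> h; rewrite /turning -{1}(@prednK b.-1) ?big_nat_recr //=; try lia.
by rewrite prednK //; lia.
Qed.

(** Stairs are counted by their corners, since a walk of unit steps does not show its segments. *)
Definition bends (s : nat -> dir) (d e : dir) (a b : nat) : nat :=
  (\sum_(a <= i < b.-1) ((s i == d) && (s i.+1 == e)))%N.

Lemma bends_recl s d e a b : (a.+1 < b)%N ->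
  bends s d e a b = (((s a == d) && (s a.+1 == e)) + bends s d e a.+1 b)%N.
Proof. by move=> h; rewrite /bends big_ltn //; lia. Qed.

Lemma bends_recr s d e a b : (a < b.-1)%N ->
  bends s d e a b = (bends s d e a b.-1 + ((s b.-2 == d) && (s b.-1 == e)))%N.
Proof.
move=> h; rewrite /bends -{1}(@prednK b.-1) ?big_nat_recr //=; try lia.
by rewrite prednK //; lia.
Qed.

Lemma bends_gt0 s d e a b : (0 < bends s d e a b)%N ->
  exists i, [/\ (a <= i)%N, (i.+1 < b)%N, s i = d & s i.+1 = e].
Proof.
rewrite lt0n /bends sum_nat_seq_neq0 => /hasP[i]; rewrite mem_index_iota => ai.
rewrite /= eqb0 negbK => /andP[/eqP e1 /eqP e2].
by exists i; split=> //; lia.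
Qed.

(* Removing the outer steps of the initial (PX, z)- and the terminal
   (PX, z')-staircase of a walk from [a] to [b] leaves the walk from [a'] to
   [b'], which starts with [z], ends with [z'] and joins two points of a
   horizontal line. *)
Definition stair_core (X Y : nat -> int) s z z' N a1 b1 a b : Prop :=
  exists a' b', [/\ (a' < b' <= N)%N, s a' = z, s b'.-1 = z',
    Y b' = Y a' & X a' < X b' :> int] /\
    (X b' - X a' + (minn (bends s PX z a a1 + (s b.-1 == PX))
                        (bends s z' PX b1 b + (s a == PX)))%:Z <= X b - X a /\
     turning s a b =
       quarter_turn (s a) z + turning s a' b' + quarter_turn z' (s b.-1)).

(** Induction on the length. An east step dropped at either end costs one unit of distance; two
    vertical end steps are opposite and are dropped together. The terms [(s b.-1 == PX)] and
    [(s a == PX)] of [stair_core] ensure that [minn] drops by at most one per unit lost. *)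
Lemma stairs X Y s z z' N a1 b1 a b : walk X Y s ->
  z = PY /\ z' = NY \/ z = NY /\ z' = PY ->
  (a1 <= N)%N -> (b <= N)%N ->
  (forall i, (i < a1)%N -> s i = PX \/ s i = z) ->
  (forall i, (b1 <= i < N)%N -> s i = PX \/ s i = z') ->
  (forall i j, (i < j <= N)%N -> ~ meet X Y i j) ->
  (a < b)%N -> X a < X b -> Y b = Y a ->
  (s a = z \/ (0 < bends s PX z a a1)%N) ->
  (s b.-1 = z' \/ (0 < bends s z' PX b1 b)%N) ->
  stair_core X Y s z z' N a1 b1 a b.
Proof.
move=> hw hz a1N + hA hB hm; move def_n : (b - a)%N => n.
elim/ltn_ind: n => n IH in a b def_n *; move=> bN ab xab yab ha hb.
have zX : z <> PX by case: hz => -[-> _].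
have zX' : z' <> PX by case: hz => -[_ ->].
have zz' : z <> z' by case: hz => -[-> ->].
have qt0 d : quarter_turn d d = 0 by case: d.
have qtz : quarter_turn z PX = - quarter_turn PX z by case: hz => -[-> _].
have qtz' : quarter_turn PX z' = - quarter_turn z' PX by case: hz => -[_ ->].
have {}ha : s a = z \/ s a = PX /\ (0 < bends s PX z a a1)%N.
  case: ha => h; [by left|]; have [i [? ? _ _]] := bends_gt0 h.
  by case: (hA a) => [|?|?]; [lia|right|left].
have {}hb : s b.-1 = z' \/ s b.-1 = PX /\ (0 < bends s z' PX b1 b)%N.
  case: hb => h; [by left|]; have [i [? ? _ _]] := bends_gt0 h.
  by case: (hB b.-1) => [|?|?]; [lia|right|left].
have [hXa hYa] := hw a; have [hXb hYb] := hw b.-1; rewrite prednK in hXb hYb; last by lia.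
case: ha => [sa|[sa fa]]; last first.
  have [i [ai ia si si']] := bends_gt0 fa.
  have ab1 : (a.+1 < b)%N.
    rewrite ltn_neqAle ab andbT; apply/eqP => e.
    move: hb; rewrite -e /= sa => -[/esym//|[_ fb]].
    have [j [? ? _ _]] := bends_gt0 fb.
    by case: (hB i.+1) => [|e'|e']; [lia|case: zX|case: zz']; rewrite -si'.
  rewrite sa /ux /uy /= in hXa hYa.
  (* By simplicity the new start is not the endpoint, so it stays strictly to its left. *)
  have nab : ~ meet X Y a.+1 b by apply: hm; lia.
  have [|||||a' [b' [h1 [h2 h3]]]] := IH (b - a.+1)%N _ a.+1 b erefl bN ab1; try lia.
  - by rewrite /meet in nab; lia.
  - move: fa; rewrite bends_recl; last by lia.
    by case: (s a.+1 =P z); [left|rewrite andbF; right].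
  - by case: hb => [|[]]; [left|right].
  exists a', b'; split=> //; split.
    rewrite bends_recl; last by lia.
    by move: h2; rewrite sa eqxx /=; case: (_ == z); case: (s a.+1 == PX); lia.
  rewrite turning_recl // h3 sa; case: (hA a.+1) => [|->|->]; [lia| |];
  by rewrite qt0; lia.
case: hb => [sb|[sb fb]]; last first.
  have [i [ai ia si si']] := bends_gt0 fb.
  have ab1 : (a < b.-1)%N.
    rewrite -ltnS prednK; last by lia.
    rewrite ltn_neqAle ab andbT; apply/eqP => e.
    by move: sb; rewrite -e /= sa.
  rewrite sb /ux /uy /= in hXb hYb.
  have nab : ~ meet X Y a b.-1 by apply: hm; lia.
  have [||||||a' [b' [h1 [h2 h3]]]] := IH (b.-1 - a)%N _ a b.-1 erefl _ ab1; try lia.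
  - by rewrite /meet in nab; lia.
  - by left.
  - move: fb; rewrite bends_recr; last by lia.
    by case: (s b.-2 =P z'); [left|rewrite addn0; right].
  exists a', b'; split=> //; split.
    rewrite [bends s z' PX b1 b]bends_recr; last by lia.
    by move: h2; rewrite sb eqxx /=; case: (_ == z'); case: (s b.-2 == PX); lia.
  rewrite turning_recr // h3 sb; case: (hB b.-2) => [|->|->]; [lia| |];
  by rewrite qt0; lia.
(* Both end steps are vertical now; once one side has no stair left, the minimum is 0 and the
   current walk is the core. *)
case: (posnP (bends s PX z a a1)) => [fa|fa].
  exists a, b; split; first by split=> //; lia.
  by rewrite fa sa sb !qt0; case: eqP => [/esym//|_]; lia.
case: (posnP (bends s z' PX b1 b)) => [fb|fb].
  exists a, b; split; first by split=> //; lia.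
  by rewrite fb sa sb !qt0; case: eqP => [/esym//|_]; case: eqP => // _; lia.
have [i [ai ia si si']] := bends_gt0 fa.
have [j [bj jb sj sj']] := bends_gt0 fb.
have ne : (a != b.-1) by apply/eqP => e; apply: zz'; rewrite -sa -sb e.
have ux0 : ux z = 0 by case: hz => -[-> _].
have ux0' : ux z' = 0 by case: hz => -[_ ->].
have uyz : uy z' = - uy z by case: hz => -[-> ->].
rewrite sa in hXa hYa; rewrite sb in hXb hYb.
have ab1 : (a.+1 < b.-1)%N.
  have : (a.+1 != b.-1) by apply/eqP => e; move: xab; rewrite hXb -e hXa; lia.
  by move: ne; lia.
have [||||||a' [b' [h1 [h2 h3]]]] := IH (b.-1 - a.+1)%N _ a.+1 b.-1 erefl _ ab1; try lia.
- move: fa; rewrite bends_recl; last by lia.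
  by case: (s a.+1 =P z); [left|rewrite andbF; right].
- move: fb; rewrite bends_recr; last by lia.
  by case: (s b.-2 =P z'); [left|rewrite addn0; right].
exists a', b'; split=> //; split.
  move: h2; rewrite [bends s PX z a a1]bends_recl; last by lia.
  rewrite [bends s z' PX b1 b]bends_recr; last by lia.
  have /negbTE -> : s a != PX by rewrite sa; apply/eqP.
  have /negbTE -> : s b.-1 != PX by rewrite sb; apply/eqP.
  by rewrite ?andbF /=; lia.
rewrite turning_recl; last by lia.
rewrite turning_recr; last by lia.
rewrite h3 sa sb !qt0.
case: (hA a.+1) => [|->|->]; [lia| |];
  by case: (hB b.-2) => [|->|->]; rewrite ?qt0; lia.
Qed.

(** * Unit steps of a chain *)

Definition coordinate (p : dir -> int) (u : nat -> dir) (i : nat) : int :=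
  \sum_(0 <= k < i) p (u k).

Lemma walk_coordinate u : walk (coordinate ux u) (coordinate uy u) u.
Proof. by move=> i; rewrite /coordinate !big_nat_recr. Qed.

Definition start (w : seq nat) (k : nat) : nat := sumn (take k w).

Lemma startS w k : (k < size w)%N -> start w k.+1 = (start w k + nth 0 w k)%N.
Proof. by move=> kw; rewrite /start (take_nth 0%N) // sumn_rcons. Qed.

Lemma start_le w k l : (k <= l)%N -> (start w k <= start w l)%N.
Proof.
by move=> kl; rewrite /start -(subnKC kl) takeD sumn_cat leq_addr.
Qed.

Lemma start_lt w k : all (fun k => 0 < k)%N w -> (k < size w)%N ->
  (start w k < start w k.+1)%N.
Proof.
move=> /allP w0 kw; rewrite startS // -addn1 leq_add2l.
by apply: w0; apply: mem_nth.
Qed.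

(** [reshape_index w i] is the segment containing unit step [i]. *)
Definition step_dir (s : seq turn) (w : seq nat) (i : nat) : dir :=
  seg_dir s (reshape_index w i).

Lemma step_dirE s w k i : (start w k <= i < start w k.+1)%N ->
  step_dir s w i = seg_dir s k.
Proof.
move=> /andP[ki ik]; congr seg_dir.
have kw : (k < size w)%N.
  rewrite ltnNge; apply/negP => kw; move: ik.
  by rewrite /start take_oversize ?(leq_trans kw) // -(take_oversize kw) ltnNge ki.
rewrite -(subnKC ki) [LHS]flatten_indexKl //.
by rewrite -(ltn_add2l (start w k)) subnKC // -startS.
Qed.

Lemma coordinate_segment p s w k i : (start w k <= i <= start w k.+1)%N ->
  coordinate p (step_dir s w) i =
  coordinate p (step_dir s w) (start w k) + p (seg_dir s k) *+ (i - start w k).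
Proof.
move=> /andP[ki ik]; rewrite /coordinate (big_cat_nat (n := start w k)) //=.
congr (_ + _); rewrite (eq_big_nat _ _ (F2 := fun=> p (seg_dir s k))).
  by rewrite sumr_const_nat.
by move=> j /andP[h1 h2]; rewrite (@step_dirE _ _ k) // h1 (leq_trans h2).
Qed.

Lemma vertexE s w k : (k <= size w)%N ->
  vertex s w k =
  (coordinate ux (step_dir s w) (start w k), coordinate uy (step_dir s w) (start w k)).
Proof.
elim: k => [|k IH] kw.
  by rewrite /vertex big_ord0 /start take0 /coordinate !big_geq.
rewrite /vertex big_ord_recr /= -/(vertex s w k) IH; last exact: ltnW.
have h : (start w k <= start w k.+1 <= start w k.+1)%N by rewrite leqnn start_le.
rewrite !(coordinate_segment _ _ h) startS // addKn.
rewrite /ux /uy; case: (unit_vec _) => a b.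
have -> : forall m, (a, b) *+ m = (a *+ m, b *+ m).
  by elim=> [|m IHm]; rewrite ?mulr0n // !mulrS IHm.
by [].
Qed.

Lemma find_segment w i : (i < sumn w)%N ->
  exists2 k, (k < size w)%N & (start w k <= i < start w k.+1)%N.
Proof.
move=> iw; exists (reshape_index w i); first exact: reshape_indexP.
rewrite startS; last exact: reshape_indexP.
have := reshape_offsetP iw; have := reshape_indexK w i.
rewrite /flatten_index; move: (reshape_index w i) (reshape_offset w i) => k o <- h.
by rewrite leq_addr ltn_add2l.
Qed.

Lemma unit_vec_mulIn d m n : ux d *+ m = ux d *+ n -> uy d *+ m = uy d *+ n -> m = n.
Proof.
by rewrite /ux /uy; case: d => /=; rewrite ?mulNrn ?mul0rn // => + +; lia.
Qed.

(** On one segment vertices are distinct. On two, simplicity makes a common vertex their bend, but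
    [i] is chosen strictly before the end of its segment. *)
Lemma simple_steps (R : realType) s w : realizes R s w ->
  forall i j, (i < j <= sumn w)%N ->
  ~ meet (coordinate ux (step_dir s w)) (coordinate uy (step_dir s w)) i j.
Proof.
case=> sw w0 simple i j /andP[ij jw] [eX eY].
set X := coordinate ux (step_dir s w) in eX; set Y := coordinate uy (step_dir s w) in eY.
have [k ks /andP[ki ik]] := find_segment (leq_trans ij jw).
have [l ls /andP[lj jl]] : exists2 l, (l < size w)%N & (start w l <= j <= start w l.+1)%N.
  move: jw; rewrite leq_eqVlt => /orP[/eqP ->|/find_segment[l h1 /andP[h2 h3]]].
    exists (size s); first by rewrite sw.
    have -> : sumn w = start w (size s).+1 by rewrite /start -sw take_size.
    by rewrite leqnn start_le.
  by exists l; rewrite // h2 ltnW.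
have kl : (k <= l)%N.
  rewrite leqNgt; apply/negP => lk; have := start_le w lk.
  by move: ki ij jl; lia.
have hXi := coordinate_segment ux s (w := w) (k := k) (i := i).
have hYi := coordinate_segment uy s (w := w) (k := k) (i := i).
have hXj := coordinate_segment ux s (w := w) (k := l) (i := j).
have hYj := coordinate_segment uy s (w := w) (k := l) (i := j).
rewrite ki (ltnW ik) in hXi hYi; rewrite lj jl in hXj hYj.
move: (hXi isT) (hYi isT) (hXj isT) (hYj isT) => {hXi hYi hXj hYj}.
rewrite -/X -/Y => hXi hYi hXj hYj.
have pt m h : (m < size w)%N -> (start w m <= h <= start w m.+1)%N ->
    chain_segment s w m (embed R (X h, Y h)).
  move=> mw hm; rewrite /chain_segment /segment /= !vertexE ?(ltnW mw) //.
  exists ((h - start w m)%N%:R / (nth 0%N w m)%:R).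
  have wm : (0 < (nth 0%N w m)%:R :> R).
    by rewrite ltr0n; apply: (allP w0); apply: mem_nth.
  have := startS mw => e; split.
    by rewrite divr_ge0 // ler_pdivrMr // mul1r ler_nat; lia.
  have hend : (start w m <= start w m.+1 <= start w m.+1)%N by rewrite leqnn andbT; lia.
  have key p : (coordinate p (step_dir s w) h)%:~R =
     (1 - (h - start w m)%:R / (nth 0 w m)%:R) * (coordinate p (step_dir s w) (start w m))%:~R
     + (h - start w m)%:R / (nth 0 w m)%:R * (coordinate p (step_dir s w) (start w m.+1))%:~R :> R.
    rewrite (coordinate_segment _ _ hm) (coordinate_segment _ _ hend) e addKn.
    rewrite !rmorphD !rmorphMn /= mulrDr addrA -mulrDl subrK mul1r.
    congr (_ + _); rewrite -[X in _ = _ * X]mulr_natl mulrA divfK ?lt0r_neq0 //.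
    by rewrite mulr_natl.
  by rewrite /embed /=; congr (_, _); exact: key.
have {}kl : (k < l)%N.
  rewrite ltn_neqAle kl andbT; apply/eqP => e; subst l.
  have := @unit_vec_mulIn (seg_dir s k) (i - start w k) (j - start w k).
  by move: eX eY; rewrite hXi hYi hXj hYj => /addrI -> /addrI -> /(_ erefl erefl); lia.
have [] := simple k l (embed R (X i, Y i)).
- by rewrite kl -ltnS -sw.
- by apply: pt => //; rewrite ki ltnW.
- by rewrite eX eY; apply: pt => //; rewrite lj.
move=> el; rewrite vertexE; last exact: ltnW.
rewrite /embed /= -/X -/Y => -[/intr_inj e1 /intr_inj e2].
have hend : (start w k <= start w k.+1 <= start w k.+1)%N by rewrite leqnn start_le.
move: e1 e2; rewrite el /X /Y !(coordinate_segment _ _ hend) -/X -/Y hXi hYi.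
by move=> /addrI e1 /addrI e2; have := unit_vec_mulIn e1 e2; lia.
Qed.

(** Only bends contribute, as [g] is neutral inside a segment. The general operation serves both
    [turning] and [bends]. *)
Lemma big_steps (V : Type) (idx : V) (op : Monoid.law idx) (g : dir -> dir -> V)
    s w k l : (forall d, g d d = idx) -> all (fun k => 0 < k)%N w ->
  (k <= l < size w)%N ->
  \big[op/idx]_(start w k <= i < (start w l.+1).-1)
     g (step_dir s w i) (step_dir s w i.+1) =
  \big[op/idx]_(k <= j < l) g (seg_dir s j) (seg_dir s j.+1).
Proof.
move=> g0 w0 /andP[kl lw].
have inside m : (m < size w)%N -> \big[op/idx]_(start w m <= i < (start w m.+1).-1)
    g (step_dir s w i) (step_dir s w i.+1) = idx.
  move=> mw; rewrite big1_seq // => i; rewrite mem_index_iota => /andP[_ h].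
  by rewrite !(@step_dirE _ _ m) //; lia.
move: lw; rewrite -(subnKC kl); elim: (l - k)%N => [|m IH] lw.
  by rewrite addn0 in lw *; rewrite inside // big_geq.
rewrite addnS in lw *.
have lt1 := start_lt w0 (ltnW lw); have lt2 := start_lt w0 lw.
have le : (start w k <= start w (k + m))%N by apply: start_le; rewrite leq_addr.
rewrite (big_cat_nat (n := (start w (k + m).+1).-1)) /=; [|lia|lia].
rewrite IH; last exact: ltnW.
rewrite [in RHS]big_nat_recr /=; last exact: leq_addr.
congr (op _ _); rewrite big_ltn; last by lia.
rewrite prednK; last by lia.
rewrite inside // Monoid.mulm1; congr g; apply: step_dirE; last by lia.
by apply/andP; split; lia.
Qed.

(** * Turns, segment directions and staircase counts *)

Definition turn_sign (t : turn) : int := if t is LT then 1 else -1.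

Lemma deltaS s j : (j < size s)%N -> delta s j.+1 = delta s j + turn_sign (nth LT s j).
Proof.
move=> js; rewrite /delta (take_nth LT) // -cats1 !count_cat /=.
by case: (nth LT s j) => /=; lia.
Qed.

Lemma quarter_turn_seg s j : (j < size s)%N ->
  quarter_turn (seg_dir s j) (seg_dir s j.+1) = turn_sign (nth LT s j).
Proof.
move=> js; rewrite /seg_dir deltaS //; move: (delta s j) => m.
rewrite (divz_eq m 4); set q := (m %/ 4)%Z.
have : 0 <= (m %% 4)%Z < 4 by lia.
case: (m %% 4)%Z => // -[|[|[|[|r]]]] //= _; rewrite -!addrA !modzMDl;
  by case: (nth LT s j).
Qed.

Lemma turning_steps s w k l : all (fun k => 0 < k)%N w -> size w = (size s).+1 ->
  (k <= l <= size s)%N ->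
  turning (step_dir s w) (start w k) (start w l.+1) = delta s l - delta s k.
Proof.
move=> w0 sw /andP[kl ls]; rewrite /turning big_steps //; last by rewrite sw ltnS kl.
  rewrite -(telescope_sumr (delta s) kl); apply: eq_big_nat => j h.
  have js : (j < size s)%N by lia.
  by rewrite quarter_turn_seg // deltaS // addrAC subrr add0r.
by case.
Qed.

Lemma bends_steps s w d e k l : d <> e -> all (fun k => 0 < k)%N w ->
  size w = (size s).+1 -> (k <= l <= size s)%N ->
  bends (step_dir s w) d e (start w k) (start w l.+1) =
  (\sum_(k <= j < l) ((seg_dir s j == d) && (seg_dir s j.+1 == e)))%N.
Proof.
move=> de w0 sw kl; rewrite /bends.
rewrite (@big_steps _ _ _ (fun a b => nat_of_bool ((a == d) && (b == e)))) //.
  by move=> c; case: eqP => // ->; case: eqP.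
by rewrite sw ltnS.
Qed.

Lemma seg_dir_neqS s j : (j < size s)%N -> seg_dir s j <> seg_dir s j.+1.
Proof.
move=> js e; have := quarter_turn_seg js; rewrite e.
by case: (seg_dir _ _); case: (nth _ _ _).
Qed.

Lemma seg_dir0 s : seg_dir s 0 = PX.
Proof. by rewrite /seg_dir /delta take0. Qed.

Lemma nth_dirs s j : (j <= size s)%N -> nth PX (dirs s) j = seg_dir s j.
Proof. by move=> js; rewrite (nth_map 0%N) ?size_iota // nth_iota. Qed.

Lemma size_dirs s : size (dirs s) = (size s).+1.
Proof. by rewrite size_map size_iota. Qed.

Lemma count_map_iota (f : nat -> dir) z m k :
  count_mem z [seq f j | j <- iota m k] = (\sum_(m <= j < m + k) (f j == z))%N.
Proof.
rewrite -sum1_count big_map big_mkcond /= /index_iota addKn.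
by apply: eq_bigr => j _; case: eqP.
Qed.

(** Consecutive segments differ and the first one is [PX], so each [z]-segment of the staircase
    follows a [PX]-segment. [K] is the last segment of the staircase. *)
Lemma m_oE s z : z <> PX -> exists K, [/\ (K <= size s)%N,
  forall j, (j <= K)%N -> seg_dir s j = PX \/ seg_dir s j = z,
  (K < size s)%N -> seg_dir s K.+1 <> z &
  m_o z s = (\sum_(0 <= j < K) ((seg_dir s j == PX) && (seg_dir s j.+1 == z)))%N].
Proof.
move=> zX; rewrite /m_o /staircase_count /initial_run.
set P : pred dir := mem _; set F := find _ _.
have PE d : P d = (d == PX) || (d == z) by rewrite -[LHS]/(d \in [:: PX; z]) !inE.
have F0 : (0 < F)%N by rewrite /F /dirs /= seg_dir0.
have FS : (F <= (size s).+1)%N by rewrite -size_dirs find_size.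
have inP j : (j < F)%N -> seg_dir s j = PX \/ seg_dir s j = z.
  move=> jF; have := before_find PX jF; rewrite nth_dirs /=; last by lia.
  by move/negbFE; rewrite PE => /orP[]/eqP; [left|right].
exists F.-1; split; first by lia.
- by move=> j h; apply: inP; lia.
- rewrite prednK // => Fs e.
  have : has (predC P) (dirs s) by rewrite has_find -/F size_dirs; lia.
  move/(nth_find PX); rewrite -/F nth_dirs; last by lia.
  by rewrite /= e PE eqxx orbT.
rewrite /dirs -map_take take_iota (minn_idPl FS) count_map_iota add0n.
rewrite -(prednK F0) big_nat_recl // seg_dir0 /=.
have -> : (PX == z) = false by apply/eqP => /esym.
apply: eq_big_nat => j /andP[_ jF].
case: (seg_dir s j.+1 =P z) => [e|]; last by rewrite andbF.
have jF' : (j < F)%N by lia.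
case: (inP j jF') => [->|e'] //; have js : (j < size s)%N by lia.
by case: (seg_dir_neqS js); rewrite e e'.
Qed.

(** Each [z]-segment of the staircase precedes a [PX]-segment, except a final one, which is counted
    apart. [c] is the first segment of the staircase. *)
Lemma m_pE s z : z <> PX -> seg_dir s (size s) = PX \/ seg_dir s (size s) = z ->
  exists c, [/\ (c <= size s)%N,
  forall j, (c <= j <= size s)%N -> seg_dir s j = PX \/ seg_dir s j = z,
  (0 < c)%N -> seg_dir s c.-1 <> z &
  m_p z s = (\sum_(c <= j < size s) ((seg_dir s j == z) && (seg_dir s j.+1 == PX))
             + (seg_dir s (size s) == z))%N].
Proof.
move=> zX last; rewrite /m_p /staircase_count /initial_run.
set P : pred dir := mem _; set F := find _ _.
have PE d : P d = (d == PX) || (d == z) by rewrite -[LHS]/(d \in [:: PX; z]) !inE.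
have nth_rd j : (j <= size s)%N -> nth PX (rev (dirs s)) (size s - j) = seg_dir s j.
  move=> js; rewrite nth_rev size_dirs; last by lia.
  by rewrite subSS subKn // nth_dirs.
have F0 : (0 < F)%N.
  rewrite lt0n; apply/eqP => F0.
  have : has (predC P) (rev (dirs s)) by rewrite has_find -/F F0 size_rev size_dirs.
  move/(nth_find PX); rewrite -/F F0 -(subnn (size s)) nth_rd //= PE.
  by case: last => ->; rewrite eqxx ?orbT.
have FS : (F <= (size s).+1)%N by rewrite -size_dirs -size_rev find_size.
have inP j : ((size s).+1 - F <= j <= size s)%N -> seg_dir s j = PX \/ seg_dir s j = z.
  move=> h; have jF : (size s - j < F)%N by lia.
  have := before_find PX jF; rewrite nth_rd /=; last by lia.
  by move/negbFE; rewrite PE => /orP[]/eqP; [left|right].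
exists ((size s).+1 - F)%N; split => //; first by lia.
- move=> Fs e.
  have : has (predC P) (rev (dirs s)) by rewrite has_find -/F size_rev size_dirs; lia.
  move/(nth_find PX); rewrite -/F.
  have -> : F = (size s - ((size s).+1 - F).-1)%N by lia.
  by rewrite nth_rd ?e /= ?PE ?eqxx ?orbT //; lia.
rewrite take_rev count_rev size_dirs /dirs -map_drop drop_iota count_map_iota add0n.
rewrite subnKC ?leq_subr //.
rewrite big_nat_recr /=; last by lia.
congr addn; apply: eq_big_nat => j /andP[jF js].
case: (seg_dir s j =P z) => [e|] //.
have jF' : ((size s).+1 - F <= j.+1 <= size s)%N by lia.
case: (inP _ jF') => [->|e'] //.
by case: (seg_dir_neqS js); rewrite e e'.
Qed.

(** * Bounds for chains ending on the positive x-axis *)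

(* What is known about a simple walk of turning [T] from a point to another one
   at distance [y] to its right, with end directions [d] and [e]. *)
Definition west_bound (T : int) (d e : dir) (y : int) : Prop :=
  forall ta tb, west_angle d ta -> west_angle e tb ->
  exists j, [/\ T = 4 * j + tb - ta, `|j| <= y & y = 1 -> `|j| = 1].

(** At distance 1 the open segment contains no lattice point, so [turning_tight] applies
    directly. *)
Lemma west_boundP X Y s a b : walk X Y s -> (a < b)%N ->
  (forall i j, (i < j <= b)%N -> ~ meet X Y i j) ->
  X a < X b -> Y b = Y a -> s a <> PX -> s b.-1 <> PX ->
  west_bound (turning s a b) (s a) (s b.-1) (X b - X a).
Proof.
move=> hw ab hm hX hY sa sb ta tb wa wb.
have hm' i j : (a <= i < j)%N -> (j <= b)%N -> ~ meet X Y i j.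
  by move=> h1 h2; apply: hm; lia.
have x0 : (0 < `|X b - X a|)%N by lia.
have hX' : X b = X a + `|X b - X a|%N%:Z by lia.
have [y1|y1] := eqVneq (X b - X a) 1.
  case: (turning_tight hw ab x0 hm' hX' hY sa sb _ wa wb) => [i _ _||] e; first lia.
  - by exists 1; split=> //; lia.
  - by exists (-1); split=> //; lia.
have [j [e hj]] := turning_bound hw ab x0 hm' hX' hY wa wb.
by exists j; split=> //; lia.
Qed.

Lemma reachable_walk (R : realType) s (x : nat) : (0 < x)%N -> (0 < size s)%N ->
  reachable R s (x%:Z, 0) -> exists w X Y,
  [/\ walk X Y (step_dir s w) /\ all (fun k => 0 < k)%N w /\ size w = (size s).+1,
    (forall i j, (i < j <= start w (size s).+1)%N -> ~ meet X Y i j),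
    [/\ X 0%N = 0, Y 0%N = 0, X (start w (size s).+1) = x%:Z &
        Y (start w (size s).+1) = 0],
    (forall k i, (start w k <= i <= start w k.+1)%N -> seg_dir s k = PX ->
        X i = X (start w k) + (i - start w k)%N%:Z /\ Y i = Y (start w k)) &
    [/\ 1 <= X (start w 1), X (start w 1) < x%:Z & Y (start w 1) = 0]].
Proof.
move=> x0 s0 [w hw]; have [sw w0 _] := hw; rewrite vertexE ?sw // => -[eX eY].
set X := coordinate ux (step_dir s w) in eX *.
set Y := coordinate uy (step_dir s w) in eY *.
have hm i j : (i < j <= start w (size s).+1)%N -> ~ meet X Y i j.
  by rewrite /start -sw take_size; apply: (simple_steps hw).
have X0 : X 0%N = 0 by rewrite /X /coordinate big_geq.
have Y0 : Y 0%N = 0 by rewrite /Y /coordinate big_geq.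
have east k i : (start w k <= i <= start w k.+1)%N -> seg_dir s k = PX ->
    X i = X (start w k) + (i - start w k)%N%:Z /\ Y i = Y (start w k).
  move=> hk e; rewrite /X /Y !(coordinate_segment _ _ hk) e /ux /uy /=.
  by rewrite mul0rn addr0 natz.
exists w, X, Y; split=> //; first by split; [exact: walk_coordinate|].
have st0 : start w 0 = 0%N by rewrite /start take0.
have lt0 : (0 < start w 1)%N by rewrite -{1}st0 start_lt // sw.
have lt1 : (start w 1 < start w 2)%N by rewrite start_lt // sw.
have le2 : (start w 2 <= start w (size s).+1)%N by apply: start_le.
have Xi i : (i <= start w 1)%N -> X i = i%:Z /\ Y i = 0.
  move=> h; have [] := east 0%N i _ (seg_dir0 s); first by rewrite st0.
  by rewrite st0 X0 Y0 subn0 add0r.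
have [X1 Y1] := Xi _ (leqnn _).
split=> //; first by rewrite X1.
(* A first segment of length at least [x] would visit the final point already at step [x]. *)
rewrite ltNge; apply/negP => h.
have [|Xx Yx] := Xi x; first by lia.
by apply: (hm x (start w (size s).+1)); [lia | rewrite /meet Xx Yx eX eY].
Qed.

Lemma step_dir_start s w k : all (fun k => 0 < k)%N w -> (k < size w)%N ->
  step_dir s w (start w k) = seg_dir s k.
Proof. by move=> w0 kw; apply: step_dirE; rewrite leqnn start_lt. Qed.

Lemma step_dir_pred s w k : all (fun k => 0 < k)%N w -> (k < size w)%N ->
  step_dir s w (start w k.+1).-1 = seg_dir s k.
Proof. by move=> w0 kw; apply: step_dirE; have := start_lt w0 kw; lia. Qed.

Lemma seg_dir1 s : (0 < size s)%N -> seg_dir s 1 <> PX.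
Proof. by move=> s0 e; apply: (seg_dir_neqS s0); rewrite seg_dir0. Qed.

Lemma peel_first (R : realType) s (x : nat) :
  (0 < x)%N -> (0 < size s)%N -> reachable R s (x%:Z, 0) ->
  seg_dir s (size s) <> PX -> exists y : int, [/\ 0 < y, y + 1 <= x%:Z &
    west_bound (delta s (size s) - delta s 1) (seg_dir s 1) (seg_dir s (size s)) y].
Proof.
move=> x0 s0 hr last.
have [w [X [Y [[hw [w0 sw]] hm [_ _ XN YN] _ [X1 X1x Y1]]]]] := reachable_walk x0 s0 hr.
have lt1 : (start w 1 < start w 2)%N by rewrite start_lt // sw.
have le2 : (start w 2 <= start w (size s).+1)%N by apply: start_le.
exists (x%:Z - X (start w 1)); split; try lia.
rewrite -(turning_steps w0 sw) ?s0 ?leqnn // -XN.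
have <- := step_dir_start s w0 (_ : 1 < size w)%N; last by rewrite sw.
have e := step_dir_pred s w0 (_ : size s < size w)%N; rewrite -e ?sw //.
apply: (west_boundP hw) => //; rewrite ?e ?sw ?XN ?YN //; try lia.
by rewrite step_dir_start ?sw //; apply: seg_dir1.
Qed.

Lemma peel_both (R : realType) s (x : nat) :
  (0 < x)%N -> (1 < size s)%N -> reachable R s (x%:Z, 0) ->
  seg_dir s (size s) = PX -> exists y : int, [/\ 0 < y, y + 2 <= x%:Z &
    west_bound (delta s (size s).-1 - delta s 1) (seg_dir s 1)
      (seg_dir s (size s).-1) y].
Proof.
move=> x0 s1 hr last; have s0 : (0 < size s)%N by lia.
have [w [X [Y [[hw [w0 sw]] hm [_ _ XN YN] east [X1 X1x Y1]]]]] := reachable_walk x0 s0 hr.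
have lt1 : (start w 1 < start w (size s))%N.
  by apply: leq_trans (start_le w s1); rewrite start_lt // sw.
have ltn : (start w (size s) < start w (size s).+1)%N by rewrite start_lt // sw.
have eastn i : (start w (size s) <= i <= start w (size s).+1)%N -> _ := fun h => east _ i h last.
have [|XNn YNn] := eastn (start w (size s).+1); first by lia.
(* Otherwise the last segment, heading east along the axis, would pass through the end of the first
   one, at vertex [i]. *)
have a_lt : X (start w 1) < X (start w (size s)).
  rewrite ltNge; apply/negP => h.
  pose i := (start w (size s) + `|X (start w 1) - X (start w (size s))|)%N.
  have [|Xi Yi] := eastn i; first by rewrite /i; lia.
  by apply: (hm (start w 1) i); [|split]; lia.
have en : size s = (size s).-1.+1 by lia.
exists (X (start w (size s)) - X (start w 1)); split; try lia.
rewrite -(turning_steps w0 sw); last by lia.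
rewrite -en.
have <- := step_dir_start s w0 (_ : 1 < size w)%N; last by rewrite sw.
have e := step_dir_pred s w0 (_ : (size s).-1 < size w)%N; rewrite -en in e.
rewrite -e ?sw; last by lia.
apply: (west_boundP hw) => //; rewrite ?e ?sw //; try lia.
- by move=> i j h; apply: hm; lia.
- by rewrite step_dir_start ?sw //; apply: seg_dir1.
- move=> e'; have [] := @seg_dir_neqS s (size s).-1; first by lia.
  by rewrite -en e' last.
Qed.

Lemma peel_stairs (R : realType) s (x : nat) z z' :
  (0 < x)%N -> (0 < size s)%N -> reachable R s (x%:Z, 0) ->
  z = PY /\ z' = NY \/ z = NY /\ z' = PY -> seg_dir s 1 = z ->
  seg_dir s (size s) = z' \/
    seg_dir s (size s) = PX /\ seg_dir s (size s).-1 = z' ->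
  exists (y T : int), [/\ 0 < y,
    y + (minn (m_o z s) (m_p z' s))%:Z + (seg_dir s (size s) == PX)%:Z <= x%:Z,
    delta s (size s) = quarter_turn PX z + T + quarter_turn z' (seg_dir s (size s)) &
    west_bound T z z' y].
Proof.
move=> x0 s0 hr hz sz sz'.
have zX : z <> PX by case: hz => -[-> _].
have zX' : z' <> PX by case: hz => -[_ ->].
have [w [X [Y [[hw [w0 sw]] hm [X0 Y0 XN YN] east _]]]] := reachable_walk x0 s0 hr.
set N := start w (size s).+1 in XN YN hm *.
have N0 : (0 < N)%N by apply: leq_ltn_trans (start_lt w0 (_ : size s < size w)%N); rewrite ?sw.
have [K [Ks hK endK mo]] := m_oE s zX.
have [|c [cs hc endc mp]] := m_pE zX' (s := s); first by case: sz' => [|[]]; [right|left].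
have st0 : start w 0 = 0%N by rewrite /start take0.
have uN : step_dir s w N.-1 = seg_dir s (size s) by rewrite step_dir_pred // sw.
have u0 : step_dir s w 0 = PX by rewrite -st0 step_dir_start ?sw // seg_dir0.
have bo : bends (step_dir s w) PX z 0 (start w K.+1) = m_o z s.
  by rewrite -{1}st0 bends_steps // => /esym.
have bp : (bends (step_dir s w) z' PX (start w c) N + (seg_dir s (size s) == z'))%N = m_p z' s.
  by rewrite mp bends_steps // cs leqnn.
have mo0 : (0 < m_o z s)%N.
  have K0 : (0 < K)%N.
    by rewrite lt0n; apply/eqP => K0; move: endK; rewrite K0 sz => /(_ s0).
  by rewrite mo big_ltn // seg_dir0 sz !eqxx.
have NE : sumn w = N by rewrite /N /start -sw take_size.
have seg i : (i < N)%N -> exists k, [/\ (k <= size s)%N, (start w k <= i < start w k.+1)%N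
    & step_dir s w i = seg_dir s k].
  rewrite -NE => /find_segment[k kw hk]; exists k; split=> //.
    by rewrite -ltnS -sw.
  exact: step_dirE.
have [a [b [[/andP[ab bN] sa sb Yab Xab] [hmin hT]]]] :
    stair_core X Y (step_dir s w) z z' N (start w K.+1) (start w c) 0 N.
  apply: stairs => //.
  - exact: start_le.
  - move=> i iK; have [|k [ks hk ->]] := seg i.
      by apply: leq_trans iK _; apply: start_le.
    apply: hK; rewrite leqNgt; apply/negP => lt.
    by have := start_le w lt; lia.
  - move=> i /andP[ci iN]; have [k [ks hk ->]] := seg i iN.
    apply: hc; rewrite ks andbT leqNgt; apply/negP => lt.
    by have := start_le w lt; lia.
  - by rewrite X0 XN; lia.
  - by rewrite YN.
  - by right; rewrite bo.
  - rewrite uN; case: sz' => [->|[e1 e2]]; [by left|right].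
    have : (0 < m_p z' s)%N.
      have en : size s = (size s).-1.+1 by lia.
      have cn : (c < size s)%N.
        rewrite ltn_neqAle cs andbT; apply/eqP => ec.
        by apply: endc; rewrite ec // e2.
      have -> : m_p z' s = (1 + (m_p z' s).-1)%N; last by [].
      rewrite mp en big_nat_recr /=; last by lia.
      by rewrite e2 -en e1 !eqxx; lia.
    by rewrite -bp e1; case: eqP => [/esym//|_]; rewrite addn0.
have := turning_steps w0 sw (_ : 0 <= size s <= size s)%N; rewrite leqnn st0 -/N.
move=> /(_ isT); rewrite hT u0 uN {2}/delta take0 /= subr0 => eT.
exists (X b - X a), (turning (step_dir s w) a b); split=> //; first by lia.
  (* The first step is east, which adds 1 to the terminal corners. This makes up for a final
     [z']-segment, which has no corner; if the chain ends east, both arguments of [minn] gain 1. *)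
  move: hmin; rewrite bo u0 eqxx uN X0 XN subr0 -bp.
  have /negbTE zXb : z' != PX by apply/eqP.
  by case: sz' => [e|[e _]]; rewrite e ?zXb ?[PX == z']eq_sym ?zXb !eqxx /=; lia.
rewrite -{1}sa -{1}sb; apply: (west_boundP hw) => //; rewrite ?sa ?sb //.
by move=> i j h; apply: hm; lia.
Qed.

(** * From reached points to the maximum *)

Lemma size_has_turns l r s : has_turns l r s -> size s = (l + r)%N.
Proof.
case/andP=> /eqP <- /eqP <-; rewrite -(count_predC (pred1 LT)); congr addn.
by apply: eq_count; case.
Qed.

Lemma xplus_max_ge (R : realType) l r s (B : int) : has_turns l r s ->
  reaches_pos_xaxis R s -> (forall x, xaxis_dists R s x -> B <= x%:Z) ->
  B <= (xplus_max R l r)%:Z.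
Proof.
move=> hs hreach hB; have ss := size_has_turns hs.
have hs' : size s == (l + r)%N by apply/eqP.
have le : (xplus R s <= xplus_max R l r)%N.
  apply: (@leq_bigmax_cond _ _ (fun t : (l + r).-tuple turn => xplus R t) (Tuple hs')).
  by rewrite /= hs; apply/asboolP.
apply: (@le_trans _ _ (xplus R s)%:Z); last by rewrite lez_nat.
apply: hB; rewrite /xplus.
have [m /asboolP hm min_m] : exists2 m, `[< xaxis_dists R s m >] &
    forall b, `[< xaxis_dists R s b >] -> (m <= b)%N.
  have ex : exists m, `[< xaxis_dists R s m >] by case: hreach => m hm; exists m; apply/asboolP.
  by case: (ex_minnP ex) => m; exists m.
(* A least reached distance exists, so [xget] does not return its default 0. *)
have [] // := @xgetPex _ 0%N [set a | xaxis_dists R s a /\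
  forall b, xaxis_dists R s b -> (a <= b)%N]%classic.
by exists m; split=> // b hb; apply: min_m; apply/asboolP.
Qed.

Lemma seg_dir_mod s j (m : nat) : (delta s j = m%:Z %[mod 4])%Z -> (m < 4)%N ->
  seg_dir s j = dir_of_nat m.
Proof. by rewrite /seg_dir => -> m4; rewrite modz_nat modn_small. Qed.

Theorem theorem25 (R : realType) (l r : nat) (s : seq turn)
    (hs : has_turns l r s) (hlr : 0 <= l%:Z - r%:Z)
    (hreach : reaches_pos_xaxis R s) :
  let d : int := l%:Z - r%:Z in
  let X : int := (xplus_max R l r)%:Z in
  let mo (z : dir) : int := (m_o z s)%:Z in
  let mp (z : dir) : int := (m_p z s)%:Z in
  let first (t : turn) : Prop := ohead s = Some t in
  (* (1) *)
  ((d = 1 %[mod 4])%Z ->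
    (first RT -> X >= Num.min (mo NY) (mp PY) + ((d + 2) %/ 4)%Z + 1) /\
    (first LT -> X >= `|((d + 2) %/ 4)%Z - 1| + 2)) /\
  (* (2) *)
  ((d = 3 %[mod 4])%Z ->
    (first LT ->
      X >= Num.min (mo PY) (mp NY) + `|(d %/ 4)%Z - 1| + 1 /\
      Num.min (mo PY) (mp NY) + `|(d %/ 4)%Z - 1| + 1
        = Num.min (mo PY) (mp NY) + `|((d + 2) %/ 4)%Z - 2| + 1) /\
    (first RT ->
      X >= (d %/ 4)%Z + 2 /\ (d %/ 4)%Z + 2 = ((d + 2) %/ 4)%Z + 1)) /\
  (* (3) *)
  ((d = 2 %[mod 4])%Z ->
    (first LT ->
      X >= `|(d %/ 4)%Z - 1| + 2 /\
      `|(d %/ 4)%Z - 1| + 2 = `|((d + 2) %/ 4)%Z - 2| + 2) /\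
    (first RT ->
      X >= (d %/ 4)%Z + 2 /\ (d %/ 4)%Z + 2 = ((d + 2) %/ 4)%Z + 1)) /\
  (* (4) *)
  ((d = 0 %[mod 4])%Z -> 8 <= d ->
    (first LT ->
      X >= Num.min (Num.min (mo PY) (mp NY)) 2 + ((d + 2) %/ 4)%Z) /\
    (first RT -> X >= ((d + 2) %/ 4)%Z + 2)) /\
  (* (5) *)
  (d = 0 ->
    (first LT -> X >= Num.min (Num.min (mo PY) (mp NY)) 2 + 2) /\
    (first RT -> X >= Num.min (Num.min (mo NY) (mp PY)) 2 + 2)) /\
  (* (6) *)
  (d = 4 -> X >= 3).
Proof.
move=> d X mo mp first.
have dn : delta s (size s) = d.
  by rewrite /delta take_size; case/andP: hs => /eqP -> /eqP ->.
have ss := size_has_turns hs.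
have first1 t : first t -> [/\ (0 < size s)%N, delta s 1 = turn_sign t &
    seg_dir s 1 = if t is LT then PY else NY].
  move=> ht; have [s0 e1] : (0 < size s)%N /\ delta s 1 = turn_sign t.
    by move: ht; rewrite /first; case: (s) => //= t' s' [->];
    rewrite /delta /= take0; case: t.
  by split=> //; rewrite /seg_dir e1; case: t ht e1.
have geX (B : int) : (forall x, (0 < x)%N -> reachable R s (x%:Z, 0) -> B <= x%:Z) -> B <= X.
  by move=> h; apply: (xplus_max_ge hs hreach) => x [x0 hx]; apply: h.
have minE a b : Num.min (a%:Z) (b%:Z) = (minn a b)%:Z :> int by lia.
have lastPX : (d = 0 %[mod 4])%Z -> (0 < size s)%N ->
    [/\ (1 < size s)%N, seg_dir s (size s) = PX &
      seg_dir s (size s).-1 = PY /\ delta s (size s).-1 = d + 1 \/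
      seg_dir s (size s).-1 = NY /\ delta s (size s).-1 = d - 1].
  move=> d0 s0; have s1 : (1 < size s)%N by lia.
  have lt : ((size s).-1 < size s)%N by lia.
  have e := @seg_dir_mod s (size s) 0; rewrite dn in e; split=> //; first exact: e.
  have := quarter_turn_seg lt; have := deltaS lt; rewrite prednK // dn e //=.
  by case: (seg_dir _ _); case: (nth _ _ _) => //= -> _; [left|right]; split=> //; lia.
split; [|split; [|split; [|split; [|split]]]].
(* The chain ends upwards: after a right turn both staircases lie below the axis and are removed;
   after a left turn only the first segment is cut. *)
- move=> d1; have last : seg_dir s (size s) = PY by apply: (@seg_dir_mod _ _ 1); rewrite ?dn.
  split=> /first1[s0 e1 sd1]; apply: geX => x x0 hx.
    have [||y [T [y0 hy eT wb]]] := peel_stairs x0 s0 hx _ sd1 (z' := PY); try by left.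
      by right.
    have [j [ej hj _]] := wb 1 (-1) erefl erefl.
    move: hy eT; rewrite dn last minE /=; lia.
  have [|y [y0 hy wb]] := peel_first x0 s0 hx; first by rewrite last.
  (* Here [4 * j = d - 1]; for [d = 1] this gives [j = 0], hence [y >= 2], which accounts for the
     absolute value. *)
  rewrite sd1 last in wb; have [j [ej hj hj1]] := wb (-1) (-1) erefl erefl.
  by rewrite dn e1 /= in ej; lia.
(* The chain ends downwards, so left and right first turns exchange roles. *)
- move=> d3; have last : seg_dir s (size s) = NY by apply: (@seg_dir_mod _ _ 3); rewrite ?dn.
  split=> /first1[s0 e1 sd1]; (split; last by lia); apply: geX => x x0 hx.
    have [||y [T [y0 hy eT wb]]] := peel_stairs x0 s0 hx _ sd1 (z' := NY); try by left.
    have [j [ej hj hj1]] := wb (-1) 1 erefl erefl.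
    move: hy eT; rewrite dn last minE /=; lia.
  have [|y [y0 hy wb]] := peel_first x0 s0 hx; first by rewrite last.
  rewrite sd1 last in wb; have [j [ej hj hj1]] := wb 1 1 erefl erefl.
  by rewrite dn e1 /= in ej; lia.
(* A last segment heading west belongs to no staircase, so only the first segment is cut. *)
- move=> d2; have last : seg_dir s (size s) = NX by apply: (@seg_dir_mod _ _ 2); rewrite ?dn.
  split=> /first1[s0 e1 sd1]; (split; last by lia); apply: geX => x x0 hx;
    have [|y [y0 hy wb]] := peel_first x0 s0 hx; try by rewrite last.
    rewrite sd1 last in wb; have [j [ej hj hj1]] := wb (-1) 0 erefl erefl.
    by rewrite dn e1 /= in ej; lia.
  rewrite sd1 last in wb; have [j [ej hj hj1]] := wb 1 0 erefl erefl.
  by rewrite dn e1 /= in ej; lia.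
(* After a left turn, a penultimate segment going down allows removing staircases; otherwise cutting
   both end segments gains 2, the cap in the minimum. *)
- move=> d0 d8; split=> /first1[s0 e1 sd1]; apply: geX => x x0 hx;
    have [s1 last [[last' e']|[last' e']]] := lastPX d0 s0.
  + have [y [y0 hy wb]] := peel_both x0 s1 hx last.
    rewrite sd1 last' in wb; have [j [ej hj hj1]] := wb (-1) (-1) erefl erefl.
    by rewrite e' e1 /= in ej; lia.
  + have [||y [T [y0 hy eT wb]]] := peel_stairs x0 s0 hx _ sd1 (z' := NY); try by [left|right].
    have [j [ej hj hj1]] := wb (-1) 1 erefl erefl.
    move: hy eT; rewrite dn last minE /=; lia.
  + have [y [y0 hy wb]] := peel_both x0 s1 hx last.
    rewrite sd1 last' in wb; have [j [ej hj hj1]] := wb 1 (-1) erefl erefl.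
    by rewrite e' e1 /= in ej; lia.
  + have [y [y0 hy wb]] := peel_both x0 s1 hx last.
    rewrite sd1 last' in wb; have [j [ej hj hj1]] := wb 1 1 erefl erefl.
    by rewrite e' e1 /= in ej; lia.
(* Cutting both ends gives [j = 0], hence [y >= 2]; with staircases [y >= 1] suffices. *)
- move=> d0; have d0' : (d = 0 %[mod 4])%Z by rewrite d0.
  split=> /first1[s0 e1 sd1]; apply: geX => x x0 hx;
    have [s1 last [[last' e']|[last' e']]] := lastPX d0' s0.
  + have [y [y0 hy wb]] := peel_both x0 s1 hx last.
    rewrite sd1 last' in wb; have [j [ej hj hj1]] := wb (-1) (-1) erefl erefl.
    by rewrite e' e1 /= in ej; lia.
  + have [||y [T [y0 hy eT wb]]] := peel_stairs x0 s0 hx _ sd1 (z' := NY); try by [left|right].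
    by move: hy; rewrite last minE /=; lia.
  + have [||y [T [y0 hy eT wb]]] := peel_stairs x0 s0 hx _ sd1 (z' := PY); try by [left|right].
    by move: hy; rewrite last minE /=; lia.
  + have [y [y0 hy wb]] := peel_both x0 s1 hx last.
    rewrite sd1 last' in wb; have [j [ej hj hj1]] := wb 1 1 erefl erefl.
    by rewrite e' e1 /= in ej; lia.
- move=> d4; apply: geX => x x0 hx.
  have [||s1 last _] := lastPX; [by rewrite d4|by lia|].
  by have [y [y0 hy _]] := peel_both x0 s1 hx last; lia.
Qed.
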